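(* Let $a>1$ and $b_m:=[m^a]$, $m\in\mathbb N$. Let $\{t_j\}_{j\in\mathbb N}$ be a real sequence such that $$t_j=0\ \text{ if } j\notin\{b_m:m\in\mathbb N\},\qquad \lim_{m\to\infty}t_{b_m}=0 .$$ Then there exist $C>0$ and $n_0\in\mathbb N$ such that for all $n\ge n_0$ $$\left|\sum_{\substack{j=1\\ j\ne n}}^\infty\frac{t_j}{|n-j|}\right|\le C\,\frac{\log n}{n^{1-\frac1a}}+\max_{n^{1/a}-2<m<n^{1/a}+3}|t_{b_m}| .$$
   Context: $\mathbb N=\{1,2,3,\dots\}$; $[x]$ denotes the integer part of $x$. The maximum is over $m\in\mathbb N$ in the indicated range. *)

(* Defs.v *)
From mathcomp Require Import all_boot all_order all_algebra.
From mathcomp Require Import all_classical all_reals all_analysis.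
Set Implicit Arguments.
Unset Strict Implicit.
Unset Printing Implicit Defensive.
Import Order.TTheory GRing.Theory Num.Theory.
Import numFieldNormedType.Exports.

Local Open Scope classical_set_scope.
Local Open Scope ring_scope.

Definition floor_pow (R : realType) (a : R) (m : nat) : nat :=
  Num.truncn (m%:R `^ a).

(* In what follows the index 0 is never used: the positive integers are the
   naturals m with (0 < m)%N, and the value t 0 is irrelevant. *)
Definition hilbert_psum (R : realType) (t : nat -> R) (n : nat) : nat -> R :=
  fun N => \sum_(1 <= j < N | j != n) t j / `|n%:R - j%:R|.

(* The bound m < n.+3 on the iterated maximum excludes nothing: n `^ (1/a) <= n
   when 1 <= a and 0 < n, so every m in the window is below n + 3.  The window
   always contains a positive integer, and the values are nonnegative, so the
   neutral element 0 has no effect on the maximum. *)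
Definition window_max (R : realType) (a : R) (t : nat -> R) (n : nat) : R :=
  \big[Num.max/0]_(1 <= m < n.+3 |
      n%:R `^ (1 / a) - 2 < m%:R < n%:R `^ (1 / a) + 3)
    `|t (floor_pow a m)|.

(* Main.v *)
Require Import Defs.
From mathcomp Require Import all_boot all_order all_algebra.
From mathcomp Require Import all_classical all_reals all_analysis.
From mathcomp Require Import zify ring lra.
Import Order.TTheory GRing.Theory Num.Theory.
Import numFieldNormedType.Exports.
Local Open Scope classical_set_scope.
Local Open Scope ring_scope.

(** Write x = n^(1/a) and p = x^(a-1) = n^(1-1/a), so that n = x^a.  The points
    b_m = [m^a] are sparse near n: since z^a = z * z^(a-1),
      |m^a - x^a| >= |m - x| * max(m, x)^(a-1),
    and for |m - x| >= 1/2 and p >= 4 rounding m^a down to b_m costs at most half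
    of this gap ([dist_floor_pow_ge]).  Distinct m give distinct b_m, as the gaps
    of m^a are at least 1 ([floor_pow_ltS]), so the series over j is dominated by the
    series over m of |t_(b_m)| / |n - b_m| ([sum_le_sum_comp]), which is treated
    in two parts.

    At most one m satisfies |m - x| < 1/2.  It lies in the window of the maximum,
    and |n - b_m| >= 1 there because n and b_m are distinct integers; this is why
    the maximum occurs with coefficient exactly 1.

    For all other m, |t_(b_m)| is bounded by a constant M, and what remains is
    the sum of the weights 1 / (|m - x| max(m, x)^(a-1)) ([sum_weight_le]).  Up
    to m about 2x the weight is at most 1 / (p |m - x|), which sums to
    O(log x / p) by comparison with the harmonic series; beyond that |m - x| is
    comparable to m, and the sum of m^(-a) over m > 2x is O(x^(1-a)) = O(1 / p).

    These bounds hold for every partial sum of absolute values, so they give both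
    the convergence and the estimate of the limit ([psum_bounded_cvg]). *)

(** * Harmonic sums and tails of the series of powers *)

(** This is ln (1 + u) <= u at u = - 1 / (k + 1). *)
Lemma invS_le_lnB (R : realType) (k : nat) : (0 < k)%N ->
  k.+1%:R^-1 <= ln (k.+1%:R : R) - ln k%:R.
Proof.
move=> k0; have k0' : 0 < k%:R :> R by rewrite ltr0n.
have k1' : 0 < k.+1%:R :> R by rewrite ltr0n.
have ltN1 : -1 < - k.+1%:R^-1 :> R.
  by rewrite ltrN2 invf_lt1 // ltr1n ltnS.
have := le_ln1Dx ltN1.
have -> : 1 + - k.+1%:R^-1 = k%:R * k.+1%:R^-1 :> R.
  by rewrite -natr1 in k1' *; field; rewrite gt_eqF.
rewrite lnM ?lnV ?posrE ?invr_gt0 //.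
by rewrite lerNr opprB.
Qed.

Lemma harmonic_le_ln (R : realType) (q : nat) : (0 < q)%N ->
  \sum_(1 <= k < q.+1) k%:R^-1 <= 1 + ln (q%:R : R).
Proof.
elim: q => // -[|q] IH _; first by rewrite big_nat1 ln1 invr1 addr0.
rewrite big_nat_recr //=.
apply: le_trans (lerD (IH isT) (@invS_le_lnB R q.+1 isT)) _.
by move: (ln q.+1%:R) (ln q.+2%:R) => u v; lra.
Qed.

(** The discrete form of (a - 1) z^(-a) = - (z^(1-a))'.  Since
    k^(1-a) = (k+1)^(1-a) * exp ((a-1) * (ln (k+1) - ln k)), it follows from
    exp y >= 1 + y and [invS_le_lnB]. *)
Lemma powR_inv_telescope (R : realType) (a : R) (k : nat) : 1 < a -> (0 < k)%N ->
  (a - 1) * (k.+1%:R `^ a)^-1 <= k%:R `^ (1 - a) - k.+1%:R `^ (1 - a).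
Proof.
move=> a1 k0; have k0' : 0 < k%:R :> R by rewrite ltr0n.
have k1' : 0 < k.+1%:R :> R by rewrite ltr0n.
have -> : (k.+1%:R `^ a)^-1 = k.+1%:R `^ (1 - a) * k.+1%:R^-1.
  rewrite -powRN -(powR_inv1 (ltW k1')) -powRD; first by congr (_ `^ _); lra.
  by rewrite (gt_eqF k1') implybT.
have -> : k%:R `^ (1 - a) =
    k.+1%:R `^ (1 - a) * expR ((a - 1) * (ln (k.+1%:R : R) - ln k%:R)).
  rewrite /powR !gt_eqF // -expRD; congr expR; lra.
have := expR_ge1Dx ((a - 1) * (ln (k.+1%:R : R) - ln k%:R)).
have := invS_le_lnB R _ k0.
have := powR_gt0 (1 - a) k1'.
move: (k.+1%:R `^ (1 - a)) (k.+1%:R^-1) (ln _ - _) (expR _) => P v L E P0 vL LE.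
have h : (a - 1) * v <= E - 1.
  by apply: (le_trans (y := (a - 1) * L)); [rewrite ler_pM2l; lra | lra].
rewrite mulrCA -{3}[P]mulr1 -mulrBr ler_pM2l //.
Qed.

Lemma sum_powR_inv_le (R : realType) (a : R) (K N : nat) : 1 < a -> (0 < K)%N ->
  \sum_(K.+1 <= m < K.+1 + N) (m%:R `^ a)^-1 <= (a - 1)^-1 * K%:R `^ (1 - a).
Proof.
move=> a1 K0; have b0 : 0 < a - 1 by lra.
rewrite -ler_pdivrMl ?invr_gt0 // invrK mulr_sumr.
apply: (le_trans (y := K%:R `^ (1 - a) - (K + N)%:R `^ (1 - a))); last first.
  by rewrite gerBl powR_ge0.
elim: N => [|N IH]; first by rewrite addn0 big_geq // addn0 subrr.
rewrite addnS big_nat_recr /= ?leq_addr // addSn addnS.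
have := @powR_inv_telescope R a (K + N) a1; rewrite addn_gt0 K0 => /(_ isT).
lra.
Qed.

(** * The gaps of the sequence [m^a] *)

(** As z^a = z * z^(a-1), this only replaces y^(a-1) by the larger z^(a-1).  The
    factor z^(a-1) at the larger endpoint, where the mean value theorem has an
    intermediate point, is what makes the weights summable far beyond x. *)
Lemma powR_sub_ge (R : realType) (a y z : R) : 1 < a -> 0 <= y -> y <= z ->
  (z - y) * z `^ (a - 1) <= z `^ a - y `^ a.
Proof.
move=> a1 y0 yz; have z0 := le_trans y0 yz.
rewrite -!(mulr_powRB1 _ (lt_trans ltr01 a1)) // mulrBl lerD2l lerN2.
by apply: ler_wpM2l => //; apply: ge0_ler_powR; rewrite ?nnegrE //; lra.
Qed.

Lemma floor_pow_bounds (R : realType) (a : R) (m : nat) :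
  ((floor_pow a m)%:R <= m%:R `^ a) && (m%:R `^ a < (floor_pow a m)%:R + 1).
Proof. by rewrite natr1; apply: truncn_itv; exact: powR_ge0. Qed.

Lemma floor_pow_ltS (R : realType) (a : R) (m : nat) : 1 < a ->
  (floor_pow a m < floor_pow a m.+1)%N.
Proof.
move=> a1; have /andP[le_m _] := floor_pow_bounds R a m.
rewrite truncn_gt_nat -natr1; apply: (le_trans (lerD le_m (lexx 1))).
have m0 : (0 : R) <= m%:R by [].
have mS : m%:R <= m.+1%:R :> R by rewrite ler_nat.
have := powR_sub_ge _ _ _ _ a1 m0 mS.
rewrite -natr1 addrAC subrr add0r mul1r.
have : 1 <= (m%:R + 1 : R) `^ (a - 1).
  rewrite -[X in X <= _](_ : (1 : R) `^ (a - 1) = 1); last by rewrite powR1.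
  by apply: ge0_ler_powR; rewrite ?nnegrE //; have := ler0n R m; lra.
lra.
Qed.

Lemma natr_dist_ge1 (R : realDomainType) (i j : nat) :
  i != j -> 1 <= `|i%:R - j%:R| :> R.
Proof.
suff lt_dist k l : (k < l)%N -> 1 <= `|l%:R - k%:R| :> R.
  by case: ltngtP => // /lt_dist; rewrite // distrC.
by move=> kl; rewrite -natrB ?(ltnW kl) // normr_nat ler1n subn_gt0.
Qed.

(** Only for m > x does rounding down bring the point closer to x^a, by less than
    1.  There the unrounded gap is at least 4 / 2 = 2, so half of it is left. *)
Lemma dist_floor_pow_ge (R : realType) (a x : R) (m : nat) :
  1 < a -> 0 <= x -> 4 <= x `^ (a - 1) -> 2^-1 <= `|m%:R - x| ->
  `|m%:R - x| * Num.max m%:R x `^ (a - 1) <= 2 * `|x `^ a - (floor_pow a m)%:R|.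
Proof.
move=> a1 x0 p4; have /andP[bm mb] := floor_pow_bounds R a m.
have m0 : (0 : R) <= m%:R by [].
have [mx|xm] := leP (m%:R : R) x.
  have gap := powR_sub_ge _ _ _ _ a1 m0 mx.
  rewrite [`|m%:R - x|]distrC ger0_norm ?subr_ge0 // => _.
  have mxa : (m%:R : R) `^ a <= x `^ a by apply: ge0_ler_powR; rewrite ?nnegrE //; lra.
  apply: (le_trans gap); rewrite ger0_norm; lra.
have gap := powR_sub_ge _ _ _ _ a1 x0 (ltW xm).
rewrite [`|m%:R - x|]ger0_norm => [far|]; last by rewrite subr_ge0 ltW.
have p_le : 4 <= (m%:R : R) `^ (a - 1).
  by apply: le_trans p4 _; apply: ge0_ler_powR; rewrite ?nnegrE //; lra.
have prod_ge : 2^-1 * 4 <= (m%:R - x) * m%:R `^ (a - 1).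
  by apply: ler_pM => //; lra.
rewrite distrC; apply: le_trans (ler_wpM2l _ (ler_norm _)) => //.
lra.
Qed.

(** * Comparison of sums *)

(** For b strictly increasing and F supported on the values b m with m > 0, the
    sum of F up to b M equals the sum of F \o b up to M; the claim follows
    because N <= b N. *)
Lemma sum_le_sum_comp (R : realType) (b : nat -> nat) (F : nat -> R) (N : nat) :
  {homo b : i j / (i < j)%N} -> (forall j, 0 <= F j) ->
  (forall j, (0 < j)%N -> ~ (exists m, (0 < m)%N /\ j = b m) -> F j = 0) ->
  \sum_(1 <= j < N) F j <= \sum_(1 <= m < N) F (b m).
Proof.
move=> b_lt F0 Fb.
have le_b m : (m <= b m)%N.
  by elim: m => // m IH; apply: leq_ltn_trans IH (b_lt _ _ _).
have step M : \sum_(1 <= j < (b M).+1) F j = \sum_(1 <= m < M.+1) F (b m).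
  elim: M => [|M IH].
    rewrite [RHS]big_geq // big_nat big1 // => j /andP[j0 jb0].
    apply: Fb => // -[m [m0 jm]].
    by have := b_lt _ _ m0; rewrite -jm ltnNge -ltnS jb0.
  rewrite [RHS]big_nat_recr //= -IH.
  have bM : (b M < b M.+1)%N by apply: b_lt.
  rewrite big_nat_recr /=; last by lia.
  (* Strictly between b M and b M.+1 there is no value of b, so F vanishes. *)
  rewrite (big_cat_nat _ (n := (b M).+1)) //=.
  rewrite [X in _ + X + _]big_nat [X in _ + X + _]big1 ?addr0 // => j /andP[jM jS].
  apply: Fb; first by apply: leq_ltn_trans jM.
  move=> [m [_ jm]]; move: jM jS; rewrite jm.
  have [mM|Mm] := leqP m M.
    by move: mM; rewrite leq_eqVlt => /predU1P[->|/b_lt]; lia.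
  by move: Mm; rewrite leq_eqVlt => /predU1P[<-|/b_lt]; lia.
case: N => [|N]; first by rewrite !big_geq.
rewrite -step (big_cat_nat _ (n := N.+1) (p := (b N).+1)) ?ltnS //=.
by rewrite lerDl sumr_ge0.
Qed.

Lemma sum_at_most_one_le (R : realDomainType) (I : eqType) (s : seq I)
    (p : pred I) (F : I -> R) (W : R) :
  uniq s -> 0 <= W -> {in s &, forall i j, p i -> p j -> i = j} ->
  {in s, forall i, p i -> F i <= W} -> \sum_(i <- s | p i) F i <= W.
Proof.
move=> us W0 p1 FW; have [/hasP[i is_ pi]|/hasPn sp] := boolP (has p s); last first.
  by rewrite big_seq_cond big1 // => i /andP[/sp/negbTE->].
rewrite big_mkcond (bigD1_seq i) //= pi big1_seq ?addr0 ?FW // => j /andP[ji js].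
by case: ifP => // pj; rewrite (p1 j i) ?eqxx in ji.
Qed.

(** Absolute convergence for a series whose terms are selected by a predicate and
    whose index starts at 1: extending the terms by 0 turns it into an ordinary
    series. *)
Lemma psum_bounded_cvg (R : realType) (f : nat -> R) (p : pred nat) (B : R) :
  (forall N, \sum_(1 <= j < N | p j) `|f j| <= B) ->
  cvgn (fun N => \sum_(1 <= j < N | p j) f j) /\
  `|limn (fun N => \sum_(1 <= j < N | p j) f j)| <= B.
Proof.
move=> fB; set S := fun N : nat => _.
have cS : cvgn S.
  pose u := fun j : nat => if (0 < j)%N && p j then f j else 0.
  have SE (v : R -> R) N : v 0 = 0 ->
      series (v \o u) N = \sum_(1 <= j < N | p j) v (f j).
    move=> v0; rewrite /series /= /u.
    case: N => [|N]; first by rewrite !big_geq.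
    rewrite big_ltn //= v0 add0r [RHS]big_mkcond /=; apply: eq_big_nat => j /andP[-> _] /=.
    by case: ifP.
  have -> : S = series u by apply/funext => N; rewrite /S -(SE id).
  apply: normed_cvg; apply: nondecreasing_is_cvgn.
    by apply: nondecreasing_series => j _ _ /=.
  exists B => _ [N _ <-]; rewrite /= -[leLHS]/(series (Num.norm \o u) N) SE ?normr0 //.
split => //.
rewrite -lim_norm //; apply: limr_le; first exact: is_cvg_norm.
by apply: nearW => N; apply: le_trans (ler_norm_sum _ _ _) _.
Qed.

(** * The weighted sum away from x *)

Lemma inv_le_double (R : realFieldType) (u v : R) : 0 < u -> u <= 2 * v -> v^-1 <= 2 * u^-1.
Proof.
move=> u0 uv; have v0 : 0 < v by lra.
by rewrite -[X in _ * X^-1]divr1 -ler_pdivrMl // -invfM lef_pV2 ?posrE; lra.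
Qed.

(** With q = [x], the range of m is cut at q and 2q.  Since |m - x| >= 1/2,
    2 |m - x| is at least q + 1 - m for m <= q and at least m - q for m > q, so
    each of the first two ranges gives a harmonic sum of length q.  For m > 2q the
    second bound yields |m - x| >= m / 4, and what remains is a tail of the
    series of m^(-a). *)
Lemma sum_weight_le (R : realType) (a x : R) (N : nat) : 1 < a -> 1 <= x ->
  \sum_(1 <= m < N | 2^-1 <= `|m%:R - x|)
     (`|m%:R - x| * Num.max m%:R x `^ (a - 1))^-1
  <= (4 * (1 + ln x) + 4 / (a - 1)) * x `^ (1 - a).
Proof.
move=> a1 x1; have x0 : 0 < x by lra.
set q := Num.truncn x.
have /andP[qx xq] : (q%:R <= x) && (x < q%:R + 1).
  by rewrite natr1; apply: truncn_itv; lra.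
have q0 : (0 < q)%N by rewrite truncn_gt_nat.
have q1 : (1 : R) <= q%:R by rewrite ler1n.
set w := fun m : nat => (`|m%:R - x| * Num.max m%:R x `^ (a - 1))^-1.
have w0 m : 0 <= w m by rewrite invr_ge0 mulr_ge0 ?powR_ge0.
set P := x `^ (1 - a).
have P0 : 0 < P by apply: powR_gt0.
have PE : P = (x `^ (a - 1))^-1 by rewrite /P -powRN; congr (_ `^ _); lra.
have wP m (u : R) : 0 < u -> u <= 2 * `|m%:R - x| -> w m <= 2 * P * u^-1.
  move=> u0 um; rewrite /w PE invfM mulrAC.
  apply: ler_pM; rewrite ?invr_ge0 ?powR_ge0 //; first exact: inv_le_double.
  rewrite lef_pV2 ?posrE ?powR_gt0 ?lt_max ?x0 ?orbT //.
  by apply: ge0_ler_powR; rewrite ?nnegrE ?le_max ?lexx ?(ltW x0) ?orbT //; lra.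
pose g m := if 2^-1 <= `|m%:R - x| then w m else 0.
have g0 m : 0 <= g m by rewrite /g; case: ifP.
rewrite big_mkcond /= -/(g _).
have -> : (4 * (1 + ln x) + 4 / (a - 1)) * P =
    2 * P * (1 + ln x) + 2 * P * (1 + ln x) + 4 * ((a - 1)^-1 * P).
  by rewrite /=; ring.
have lnqx : 1 + ln q%:R <= 1 + ln x.
  by rewrite lerD2l ler_ln ?posrE ?ltr0n.
(* Nonnegative terms are added so that the sum covers all three ranges. *)
apply: (le_trans (y := \sum_(1 <= m < (2 * q).+1 + N) g m)).
  case: N => [|N]; first by rewrite big_geq // sumr_ge0.
  rewrite [leRHS](big_cat_nat _ (n := N.+1)) //= ?leq_addl //.
  by rewrite lerDl sumr_ge0.
rewrite (big_cat_nat _ (n := (2 * q).+1)) ?leq_addr //=.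
rewrite (big_cat_nat _ (n := q.+1)) ?ltnS ?leq_pmull //=.
apply: lerD; first apply: lerD.
- apply: (le_trans (y := \sum_(1 <= m < q.+1) 2 * P * (q.+1 - m)%:R^-1)).
    apply: ler_sum_nat => m /andP[m0 mq]; rewrite /g; case: ifP => [far|_].
      apply: wP; first by rewrite ltr0n subn_gt0.
      rewrite natrB ?(ltnW mq) // -natr1.
      have mq' : (m%:R : R) <= q%:R by rewrite ler_nat -ltnS.
      move: far; rewrite [`|m%:R - x|]distrC ger0_norm; last by lra.
      have [-> far|mq_neq far] := eqVneq m q; first by lra.
      have mq1 : m.+1%:R <= (q%:R : R).
        by rewrite ler_nat ltn_neqAle mq_neq -ltnS.
      by rewrite -(natr1 m) in mq1; lra.
    by rewrite !mulr_ge0 ?invr_ge0 // ltW.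
  rewrite -mulr_sumr ler_pM2l ?mulr_gt0 //; apply: le_trans lnqx.
  rewrite big_nat_rev /=; apply: le_trans (harmonic_le_ln R q q0).
  by apply: ler_sum_nat => m /andP[m0 mq]; rewrite add1n subSS subKn // ltnW.
- apply: (le_trans (y := \sum_(q.+1 <= m < (2 * q).+1) 2 * P * (m - q)%:R^-1)).
    apply: ler_sum_nat => m /andP[qm _]; rewrite /g; case: ifP => [far|_].
      apply: wP; first by rewrite ltr0n subn_gt0.
      rewrite natrB ?(ltnW qm) //.
      have qm' : q%:R + 1 <= (m%:R : R) by rewrite natr1 ler_nat.
      move: far; rewrite ger0_norm; last by lra.
      have [-> far|mq_neq far] := eqVneq m q.+1; first by rewrite -(natr1 q) in far *; lra.
      have mq1 : (q.+2%:R : R) <= m%:R.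
        by rewrite ler_nat ltn_neqAle eq_sym mq_neq.
      by rewrite -(natr1 q.+1) -(natr1 q) in mq1; lra.
    by rewrite !mulr_ge0 ?invr_ge0 // ltW.
  rewrite -mulr_sumr ler_pM2l ?mulr_gt0 //; apply: le_trans lnqx.
  apply: le_trans (harmonic_le_ln R q q0).
  rewrite -[q.+1 in leLHS]add1n big_addn subSn ?mul2n -?addnn ?leq_addr // addnK.
  by apply: ler_sum_nat => m _; rewrite addnK.
- apply: (le_trans (y := \sum_((2 * q).+1 <= m < (2 * q).+1 + N) 4 * (m%:R `^ a)^-1)).
    apply: ler_sum_nat => m /andP[qm _]; rewrite /g; case: ifP => [far|_]; last first.
      by rewrite mulr_ge0 // invr_ge0 powR_ge0.
    have qm' : 2 * q%:R + 1 <= (m%:R : R) by rewrite -natrM natr1 ler_nat.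
    have m0 : 0 < (m%:R : R) by lra.
    rewrite /w ger0_norm; last by lra.
    rewrite max_l; last by lra.
    rewrite -(mulr_powRB1 (ltW m0)); last by lra.
    rewrite !invfM mulrA ler_wpM2r ?invr_ge0 ?powR_ge0 //.
    rewrite -[4]invrK -invfM lef_pV2 ?posrE; lra.
  rewrite -mulr_sumr ler_pM2l //.
  apply: le_trans (sum_powR_inv_le R a _ N a1 _) _; first by rewrite muln_gt0.
  rewrite ler_pM2l ?invr_gt0 ?subr_gt0 // PE -opprB powRN lef_pV2 ?posrE ?powR_gt0 //.
    by apply: ge0_ler_powR; rewrite ?nnegrE ?natrM //; lra.
  by rewrite ltr0n muln_gt0.
Qed.

(** * The estimate *)

Theorem lemma6p4 (R : realType) (a : R) (t : nat -> R)
  (ha : 1 < a)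
  (ht0 : forall j : nat, (0 < j)%N ->
     ~ (exists m : nat, (0 < m)%N /\ j = floor_pow a m) -> t j = 0)
  (htlim : (fun m : nat => t (floor_pow a m)) @ \oo --> (0 : R)) :
  exists C : R, 0 < C /\
    exists n0 : nat, (0 < n0)%N /\
      forall n : nat, (n0 <= n)%N ->
        cvgn (hilbert_psum t n) /\
        `|limn (hilbert_psum t n)|
          <= C * (ln (n%:R : R) / n%:R `^ (1 - 1 / a)) + window_max a t n.
Proof.
have [M [M0 tM]] : exists M : R, 0 < M /\ forall m, `|t (floor_pow a m)| <= M.
  have tcvg : cvgn (fun m : nat => t (floor_pow a m)) by apply/cvg_ex; exists 0.
  have [M0 [_ MP]] := cvg_seq_bounded tcvg.
  exists (Num.max 1 (M0 + 1)); split; first by rewrite lt_max ltr01.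
  by move=> m; apply: MP => //; rewrite lt_max ltrDl ltr01 orbT.
have e0 : 0 < 1 - 1 / a by rewrite subr_gt0 ltr_pdivrMr; lra.
exists (2 * M * (8 + 4 / (a - 1))); split.
  by rewrite !mulr_gt0 // addr_gt0 // divr_gt0; lra.
(* The threshold makes both ln n >= 1 and n^(1-1/a) >= 4. *)
exists (Num.truncn (expR 1 + 4 `^ (1 - 1 / a)^-1 : R)).+1; split => // n n0n.
have nbig : expR 1 + 4 `^ (1 - 1 / a)^-1 < n%:R :> R.
  by apply: lt_le_trans (truncnS_gt _) _; rewrite ler_nat.
have n_gt0 : 0 < n%:R :> R.
  by apply: lt_trans nbig; rewrite addr_gt0 ?expR_gt0 ?powR_gt0.
have n_ge1 : 1 <= n%:R :> R by rewrite ler1n -(ltr0n R).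
have ln1 : 1 <= ln (n%:R : R).
  rewrite -[leLHS]expRK ler_ln ?posrE ?expR_gt0 //.
  by apply: le_trans (ltW nbig); rewrite lerDl powR_ge0.
set x : R := n%:R `^ (1 / a).
have xa : x `^ a = n%:R by rewrite -powRrM divfK ?gt_eqF ?powRr1; lra.
have xp : x `^ (a - 1) = n%:R `^ (1 - 1 / a).
  by rewrite -powRrM; congr (_ `^ _); field; rewrite gt_eqF; lra.
have x_ge1 : 1 <= x.
  rewrite -(powRr0 (n%:R : R)) ler_powR // divr_ge0; lra.
have p4 : 4 <= x `^ (a - 1).
  rewrite xp -[leLHS](_ : (4 `^ (1 - 1 / a)^-1) `^ (1 - 1 / a) = 4).
    apply: ge0_ler_powR; rewrite ?nnegrE ?powR_ge0 ?ltW //.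
    by apply: lt_trans nbig; rewrite ltrDr expR_gt0.
  by rewrite -powRrM mulVf ?gt_eqF // powRr1.
have x_len : x <= n%:R by apply: ler1_powR; rewrite // ler_pdivrMr; lra.
have W0 : 0 <= window_max a t n by apply: bigmax_ge_id.
rewrite addrC; apply: psum_bounded_cvg => N.
pose F j := if j != n then `|t j / `|n%:R - j%:R| | else 0.
have F0 j : 0 <= F j by rewrite /F; case: ifP.
rewrite big_mkcond /= -/(F _).
apply: le_trans (sum_le_sum_comp _ (floor_pow a) _ _ _ F0 _) _.
- by apply: homo_ltn => [? ? ?|m]; [exact: ltn_trans | exact: floor_pow_ltS].
- move=> j j0 nj; rewrite /F; case: ifP => // _.
  by rewrite ht0 // mul0r normr0.
rewrite (bigID (fun m : nat => 2^-1 <= `|m%:R - x|)) /= addrC; apply: lerD.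
  apply: sum_at_most_one_le => //; first exact: iota_uniq.
    move=> i j _ _; rewrite -!ltNge !ltr_distl => /andP[ix xi] /andP[jx xj].
    have lt_S k l : (k%:R : R) < l%:R + 1 -> (k <= l)%N.
      by rewrite natr1 ltr_nat ltnS.
    by apply/eqP; rewrite eqn_leq !lt_S //; lra.
  move=> m; rewrite mem_index_iota -ltNge ltr_distl => /andP[m0 _] /andP[ix xi].
  apply: (le_trans (y := `|t (floor_pow a m)|)).
    rewrite /F; case: ifP => // bn.
    have d1 : 1 <= `|n%:R - (floor_pow a m)%:R| :> R by rewrite natr_dist_ge1 1?eq_sym.
    by rewrite normrM normfV normr_id ler_piMr // invf_le1 // (lt_le_trans ltr01).
  rewrite /window_max; apply: (@le_bigmax_seq _ _ _ _ _ m _ (fun m => `|t (floor_pow a m)|)).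
    by rewrite mem_index_iota m0 -(ltr_nat R) -addn3 natrD; lra.
  by rewrite -/x; lra.
apply: (le_trans (y := \sum_(1 <= m < N | 2^-1 <= `|m%:R - x|)
    2 * M * (`|m%:R - x| * Num.max m%:R x `^ (a - 1))^-1)).
  apply: ler_sum => m far.
  have den := dist_floor_pow_ge _ _ _ _ ha (le_trans ler01 x_ge1) p4 far.
  have den0 : 0 < `|m%:R - x| * Num.max m%:R x `^ (a - 1).
    rewrite mulr_gt0 ?powR_gt0 ?lt_max ?(lt_le_trans ltr01 x_ge1) ?orbT //; lra.
  rewrite /F; case: ifP => _; last by rewrite !mulr_ge0 ?invr_ge0 ?ltW.
  rewrite normrM normfV normr_id -xa [2 * M]mulrC -[leRHS]mulrA.
  by apply: ler_pM => //; exact: inv_le_double.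
rewrite -mulr_sumr -[leRHS]mulrA ler_pM2l ?mulr_gt0 //.
apply: le_trans (sum_weight_le _ _ _ _ ha x_ge1) _.
rewrite -xp [1 - a](_ : _ = - (a - 1)); last by rewrite opprB.
rewrite powRN mulrA ler_pM2r ?invr_gt0 ?powR_gt0 //.
have lnx : ln x <= ln n%:R by rewrite ler_ln ?posrE //; lra.
have b0 : 0 <= 4 / (a - 1) by rewrite divr_ge0; lra.
(* ln n >= 1 absorbs the terms without logarithm into the constant. *)
have := ler_wpM2l b0 ln1; lra.
Qed.
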